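(* Let $\mathcal{E}:=(K(a)|K,v)$ be a finite Galois extension of henselian non-trivially valued fields with non-trivial defect, i.e. $d(K(a)|K,v)>1$. Assume that $a$ is pure over $K$. Let $\{z_\nu\}_{\nu<\lambda}$ be a pseudo convergent sequence in $K$ without a limit in $K$ and which has $a$ as a limit. Then for every subgroup $H$ of $\mathcal{G}:=\mathrm{Gal}(K(a)|K)$, $$\mathcal{I}_H=\left(\frac{\sigma a-a}{a-z_\nu}\ \Big|\ \sigma\in H,\ \nu<\lambda\right),$$ where the right-hand side is the ideal of $\mathcal O_{K(a)}$ generated by the indicated elements.
   Context: $\overline{K}$ is a fixed algebraic closure of $K$; the unique extension of $v$ to $\overline K$ is again denoted $v$. $vF$ and $Fv$ denote value group and residue field, $\mathcal O_F$ the valuation ring; $\deg_K(b)=[K(b):K]$. With $p=1$ if $\operatorname{char} Kv=0$ and $p=\operatorname{char}Kv$ otherwise, the defect $d(E|K,v)$ of a finite extension is the power of $p$ with $[E:K]=(vE:vK)[Ev:Kv]\,d(E|K,v)$. For a subgroup $H$ of $\mathcal G$, $\mathcal I_H$ is the ideal of $\mathcal O_{K(a)}$ generated by all $\frac{\sigma z}{z}-1$ with $\sigma\in H$, $z\in K(a)^\times$. A pseudo convergent sequence in $K$ is a family $\{z_\nu\}_{\nu<\lambda}\subset K$, $\lambda$ a limit ordinal, with $v(z_\nu-z_\mu)<v(z_\mu-z_\rho)$ whenever $\nu<\mu<\rho<\lambda$. An element $x$ of a valued extension field is a limit of it if $v(x-z_\nu)=v(z_\nu-z_{\nu+1})$ for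 all $\nu<\lambda$. Purity: for a positive integer $d<\deg_K(a)$ put $D_d:=\{v(z-a)\mid z\in\overline K,\ \deg_K(z)=d\}$. An Okutsu sequence of $a$ over $K$ is a finite sequence $A_0=\{a\},A_1,\dots,A_n$ of subsets of $\overline K$, all elements of $A_i$ having the same degree $d_i$ over $K$, such that: (OS1) $\deg_K(a)=d_0>d_1>\dots>d_n=1$; (OS2) for all $i\geq1$ and $z\in\overline K$ with $\deg_K(z)<d_{i-1}$ there is $z_i\in A_i$ with $v(a-z_i)\geq v(a-z)$; (OS3) $v(a-z_{i-1})>v(a-z_i)$ for all $i\ge 1$, $z_i\in A_i$, $z_{i-1}\in A_{i-1}$; (OS4) for $i\geq 1$, $\#A_i=1$ if and only if $\max D_{d_i}$ exists, and then $A_i=\{a_i\}$ with $v(a-a_i)=\max D_{d_i}=\max\{v(a-z)\mid \deg_K(z)<d_{i-1}\}$; (OS5) if $\max D_{d_i}$ does not exist, then $A_i=\{z_\nu\}_{\nu<\lambda}$ with $\lambda$ a limit ordinal and $v(a-z_\mu)>v(a-z_\nu)$ for all $\nu<\mu<\lambda$. Every $a\in\overline K\setminus K$ admits an Okutsu sequence, and all its Okutsu sequences have the same length $n=:\ell_K(a)$. The element $a$ is pure over $K$ if $\ell_K(a)=1$. *)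

(* Defs.v *)
From HB Require Import structures.
From mathcomp Require Import all_boot all_order all_algebra all_fingroup all_field.
From mathcomp Require Import boolp classical_sets functions cardinality wochoice.
From mathcomp Require Import finmap.

Set Implicit Arguments.
Unset Strict Implicit.
Unset Printing Implicit Defensive.

Import Order.TTheory GRing.Theory Num.Theory.

Local Open Scope classical_set_scope.
Local Open Scope quotient_scope.
Local Open Scope ring_scope.

(* Totally ordered abelian groups: the value groups of Krull valuations of
   arbitrary rank. *)
HB.mixin Record isOrderedAbelianGroup G of Num.POrderedZmodule G := {
  oag_total : total (<=%R : rel G);
  oag_leD2l : forall z x y : G, x <= y -> z + x <= z + y
}.

#[short(type="oagType")]
HB.structure Definition OrderedAbelianGroup :=
  { G of isOrderedAbelianGroup G & Num.POrderedZmodule G }.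

(* The value group with a largest, absorbing element; [None] is infinity. *)
Definition vext (G : Type) : Type := option G.

Section Vext.
Variable G : oagType.
Implicit Types x y : vext G.

HB.instance Definition _ := Choice.copy (vext G) (option G).

Definition vext_le x y : bool :=
  match x, y with
  | _, None => true
  | None, Some _ => false
  | Some a, Some b => a <= b
  end.
Definition vext_lt x y : bool := (y != x) && vext_le x y.
Definition vext_add x y : vext G :=
  match x, y with Some a, Some b => Some (a + b) | _, _ => None end.

Fact vext_lt_def x y : vext_lt x y = (y != x) && vext_le x y.
Proof. by []. Qed.
Fact vext_le_refl : reflexive vext_le.
Proof. by case=> //= a; exact: lexx. Qed.
Fact vext_le_anti : antisymmetric vext_le.
Proof. by case=> [a|] [b|] //= /le_anti ->. Qed.
Fact vext_le_trans : transitive vext_le.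
Proof. by case=> [a|] [b|] [c|] //=; exact: le_trans. Qed.
Fact vext_le_total : total vext_le.
Proof. by case=> [a|] [b|] //=; exact: oag_total. Qed.

HB.instance Definition _ := Order.isPOrder.Build ring_display (vext G)
  vext_lt_def vext_le_refl vext_le_anti vext_le_trans.
HB.instance Definition _ :=
  Order.POrder_isTotal.Build ring_display (vext G) vext_le_total.

Fact vext_addA : associative vext_add.
Proof. by case=> [a|] [b|] [c|] //=; rewrite addrA. Qed.
Fact vext_addC : commutative vext_add.
Proof. by case=> [a|] [b|] //=; rewrite addrC. Qed.
Fact vext_add0 : left_id (Some 0 : vext G) vext_add.
Proof. by case=> [a|] //=; rewrite add0r. Qed.

HB.instance Definition _ :=
  GRing.isNmodule.Build (vext G) vext_addA vext_addC vext_add0.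
End Vext.

Record valuation (F : fieldType) (G : oagType) := Valuation {
  vfun :> F -> vext G;
  val_infty : forall x, vfun x = None <-> x = 0;
  valM : forall x y, vfun (x * y) = vfun x + vfun y;
  valD : forall x y, Order.min (vfun x) (vfun y) <= vfun (x + y)
}.

Section Restriction.
Variables (E F : fieldType) (G : oagType).
Variables (v : valuation F G) (f : {rmorphism E -> F}).

Fact vrestr_infty x : v (f x) = None <-> x = 0.
Proof.
split=> [/val_infty/eqP|->]; first by rewrite fmorph_eq0 => /eqP.
by apply/val_infty; rewrite rmorph0.
Qed.
Fact vrestrM x y : v (f (x * y)) = v (f x) + v (f y).
Proof. by rewrite rmorphM valM. Qed.
Fact vrestrD x y : Order.min (v (f x)) (v (f y)) <= v (f (x + y)).
Proof. by rewrite rmorphD valD. Qed.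

Definition vrestr : valuation E G := Valuation vrestr_infty vrestrM vrestrD.
End Restriction.

(* Valuations are only considered up to an isomorphism of value groups. *)
Definition vequiv (F : fieldType) (G1 G2 : oagType)
    (v : valuation F G1) (w : valuation F G2) : Prop :=
  forall x y, (v x <= v y) = (w x <= w y).

Definition nontrivial_valuation (F : fieldType) (G : oagType)
    (v : valuation F G) : Prop :=
  exists2 x : F, x != 0 & v x != 0.

Definition algebraic_ext (K F : fieldType) (f : {rmorphism K -> F}) : Prop :=
  forall x : F, algebraicOver f x.

Definition henselian (K : fieldType) (G : oagType) (v : valuation K G) : Prop :=
  forall (F : fieldType) (f : {rmorphism K -> F}), algebraic_ext f ->
  forall (G1 G2 : oagType) (w1 : valuation F G1) (w2 : valuation F G2),
    vequiv (vrestr w1 f) v -> vequiv (vrestr w2 f) v -> vequiv w1 w2.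

Section ValuationRing.
Variables (F : fieldType) (G : oagType) (v : valuation F G).

Definition vint : {pred F} := fun x => (0 : vext G) <= v x.

Fact val1 : v 1 = 0.
Proof.
have := valM v 1 1; rewrite mulr1.
case E: (v 1) => [a|] => [[a0]|]; last first.
  by move/val_infty: E => /eqP; rewrite oner_eq0.
by congr Some; apply: (addrI a); rewrite addr0 -a0.
Qed.

Fact valN1 : v (-1) = 0.
Proof.
have := valM v (-1) (-1); rewrite mulrNN mulr1 val1.
case: (v (-1)) => [b|] // [b0]; congr Some.
have [b_sgn|b_sgn] := orP (oag_total 0 b); apply: le_anti.
  by have := oag_leD2l b _ _ b_sgn; rewrite addr0 -b0 b_sgn => ->.
by have := oag_leD2l b _ _ b_sgn; rewrite addr0 -b0 b_sgn => ->.
Qed.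

Fact vint_subring : subring_closed vint.
Proof.
split=> [|x y|x y]; rewrite !unfold_in ?val1 // => x0 y0; last first.
  rewrite valM; case: (v x) (v y) x0 y0 => [a|] [b|] // a0 b0.
  apply: (le_trans (a0 : (0 : G) <= a)); rewrite -{1}[a]addr0.
  apply: (oag_leD2l a _ _ (b0 : (0 : G) <= b)).
apply: le_trans (valD _ _ _); rewrite le_min x0 -mulN1r valM valN1 add0r.
exact: y0.
Qed.
HB.instance Definition _ := GRing.isSubringClosed.Build F vint vint_subring.

Record vring := VRing { vring_val :> F; vringP : vring_val \in vint }.
HB.instance Definition _ := [isSub for vring_val].
HB.instance Definition _ := [Choice of vring by <:].
HB.instance Definition _ := [SubChoice_isSubComNzRing of vring by <:].

Definition vmax : {pred vring} := fun x => (0 : vext G) < v (vring_val x).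

Fact vmax_idealr : idealr_closed vmax.
Proof.
split=> [||a x y]; rewrite !unfold_in /vmax /=.
- by rewrite (proj2 (val_infty v 0) erefl).
- by rewrite val1 ltxx.
move=> x0 y0; apply: lt_le_trans (valD _ _ _).
rewrite lt_min y0 andbT valM.
have := vringP a; rewrite unfold_in.
case: (v a) (v x) x0 => [b|] [c|] // c0 b0.
apply: (lt_le_trans c0).
have := oag_leD2l c _ _ (b0 : (0 : G) <= b).
by rewrite addr0 addrC.
Qed.
HB.instance Definition _ := isIdealr.Build vring vmax vmax_idealr.

Definition residue_field := {ideal_quot vmax}.

Definition res (x : vring) : residue_field := \pi_({ideal_quot vmax}) x.
End ValuationRing.

(* The ideal of the valuation ring of [v] generated by [S], as a subset of the
   field: the finite combinations of elements of [S] with integral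
   coefficients. *)
Definition ideal_gen (F : fieldType) (G : oagType) (v : valuation F G)
    (S : set F) : set F :=
  [set x | exists (n : nat) (c s : 'I_n -> F),
     (forall i, c i \in vint v) /\ (forall i, S (s i)) /\
     x = \sum_(i < n) c i * s i].

(* The degree [T : S], for S, T subfields of R; 0 if it is infinite. *)
Definition degree_over (R : nzRingType) (S T : set R) : nat :=
  xget 0%N [set n : nat | exists b : 'I_n -> R, (forall i, T (b i)) /\
    forall x, T x -> exists! c : {ffun 'I_n -> R},
      (forall i, S (c i)) /\ x = \sum_(i < n) c i * b i].

(* The subfield K(z), the image of K being taken under [f]. *)
Definition adjunction (K F : fieldType) (f : {rmorphism K -> F}) (z : F) :
    set F :=
  [set x | exists p q : {poly K}, x = (map_poly f p).[z] / (map_poly f q).[z]].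

Definition deg (K F : fieldType) (f : {rmorphism K -> F}) (z : F) : nat :=
  degree_over (range f) (adjunction f z).

Section Defect.
Variables (K : fieldType) (G : oagType).

Section Extension.
Variables (F : fieldType) (f : {rmorphism K -> F}) (v : valuation F G).

Definition value_group (E : fieldType) (w : valuation E G) : set G :=
  [set g | exists x : E, w x = Some g].

Definition value_cosets : set (set G) :=
  [set [set g + h | h in value_group (vrestr v f)] | g in value_group v].

(* (vF : vK); 0 if it is infinite *)
Definition ramification_index : nat := #|` fset_set value_cosets|.

(* Kv, identified with its image in Fv *)
Definition base_residue_field : set (residue_field v) :=
  [set r | exists (c : K) (y : vring v), vring_val y = f c /\ res y = r].

(* [Fv : Kv] *)
Definition residue_degree : nat := degree_over base_residue_field setT.
End Extension.

Definition char_exponent (R : nzRingType) (p : nat) : Prop :=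
  p \in [pchar R] \/ (p = 1%N /\ [pchar R] =i pred0).

Definition is_defect (L : fieldExtType K) (v : valuation L G) (d : nat) :
    Prop :=
  (exists p k : nat,
     char_exponent (residue_field (vrestr v (in_alg L))) p /\ d = (p ^ k)%N) /\
  \dim {:L} =
    (ramification_index (in_alg L) v * residue_degree (in_alg L) v * d)%N.
End Defect.

(* Limit ordinals are replaced by the well-ordered types of limit order type. *)
Definition limit_order (disp : Order.disp_t) (I : orderType disp) : Prop :=
  [/\ inhabited I, well_order (<=%O : rel I)
    & forall i : I, exists j : I, (i < j)%O].

Definition is_succ (disp : Order.disp_t) (I : orderType disp) (i j : I) : Prop :=
  (i < j)%O /\ forall k : I, (i < k)%O -> (j <= k)%O.

Section PseudoConvergent.
Variables (F : fieldType) (G : oagType) (v : valuation F G).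
Variables (disp : Order.disp_t) (I : orderType disp) (z : I -> F).

Definition pseudo_convergent : Prop :=
  forall i j k : I, (i < j)%O -> (j < k)%O -> v (z i - z j) < v (z j - z k).

Definition pseudo_limit (x : F) : Prop :=
  forall i j : I, is_succ i j -> v (x - z i) = v (z i - z j).
End PseudoConvergent.

Section Okutsu.
Variables (K Kbar : fieldType) (iota : {rmorphism K -> Kbar}).
Variables (G : oagType) (v : valuation Kbar G).

Definition is_max (S : set (vext G)) (m : vext G) : Prop :=
  S m /\ forall s, S s -> s <= m.

Definition dist_set (a : Kbar) (d : nat) : set (vext G) :=
  [set v (z - a) | z in [set z | deg iota z = d]].

(* Conditions on an index i >= 1 are stated at i.+1 for i < n.  The third one is
   meaningful for i = 0 because v (a - a) is infinity. *)
Record okutsu_sequence (a : Kbar) (n : nat) (A : nat -> set Kbar)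
    (d : nat -> nat) : Prop := OkutsuSequence {
  okutsu0 : A 0%N = [set a];
  okutsu_deg : forall i z, (i <= n)%N -> A i z -> deg iota z = d i;
  okutsu1 : [/\ d 0%N = deg iota a,
                forall i, (i < n)%N -> (d i.+1 < d i)%N & d n = 1%N];
  okutsu2 : forall i z, (i < n)%N -> (deg iota z < d i)%N ->
    exists2 zi, A i.+1 zi & v (a - z) <= v (a - zi);
  okutsu3 : forall i z z', (i < n)%N -> A i.+1 z -> A i z' ->
    v (a - z) < v (a - z');
  okutsu4 : forall i, (i < n)%N ->
    ((exists b, A i.+1 = [set b]) <->
     (exists m, is_max (dist_set a (d i.+1)) m)) /\
    (forall b, A i.+1 = [set b] ->
       is_max (dist_set a (d i.+1)) (v (a - b)) /\
       is_max [set v (a - z) | z in [set z | (deg iota z < d i)%N]]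
              (v (a - b)));
  okutsu5 : forall i, (i < n)%N ->
    ~ (exists m, is_max (dist_set a (d i.+1)) m) ->
    exists (disp : Order.disp_t) (I : orderType disp) (z : I -> Kbar),
      [/\ limit_order I, A i.+1 = range z
        & forall k l : I, (k < l)%O -> v (a - z k) < v (a - z l)]
}.

(* All Okutsu sequences of an algebraic element have the same length, so that
   this relation is the graph of a function. *)
Definition okutsu_length (a : Kbar) (n : nat) : Prop :=
  exists A d, okutsu_sequence a n A d.

Definition pure (a : Kbar) : Prop := okutsu_length a 1.
End Okutsu.

Definition galois_ideal (K : fieldType) (L : splittingFieldType K)
    (G : oagType) (v : valuation L G) (H : {group gal_of {:L}}) : set L :=
  ideal_gen v
    [set y | exists s z, [/\ s \in H, z != 0 & y = s z / z - 1]].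

(* Main.v *)
Require Import Defs.
From HB Require Import structures.
From mathcomp Require Import all_boot all_order all_algebra all_fingroup all_field.
From mathcomp Require Import boolp classical_sets functions cardinality.
From mathcomp Require Import ring.

(* Purity says that an element x of degree < deg a is no closer to a than some
   c in K, and c, not being a limit of (z_nu), is no closer than some z_nu.
   A nonzero x in L is p(a) with deg p < deg a, so all roots t of p satisfy
   v(a - t) <= v(a - z_nu) for a common nu.  By henselianity v(sx) = v(x) on L,
   whence v(sa - a) >= v(a - z_nu), and
     sx / x = prod_t (1 + (sa - a) / (a - t))
   differs from 1 by a multiple of (sa - a) / (a - z_nu).  Conversely this last
   quotient is s y / y - 1 for y = a - z_nu. *)

Set Implicit Arguments.
Unset Strict Implicit.
Unset Printing Implicit Defensive.

Import Order.TTheory GRing.Theory Num.Theory.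

Local Open Scope classical_set_scope.
Local Open Scope ring_scope.

Lemma vext_leD2l (G : oagType) (z x y : vext G) : x <= y -> z + x <= z + y.
Proof. by case: x y z => [x|] [y|] [z|] //; exact: oag_leD2l. Qed.

Section ValuationTheory.
Variables (F : fieldType) (G : oagType) (v : valuation F G).
Implicit Types (x y c e a b : F) (s : seq F).

Lemma val_zero : v 0 = None.
Proof. exact/val_infty. Qed.

Lemma val_opp x : v (- x) = v x.
Proof. by rewrite -mulN1r Defs.valM Defs.valN1 add0r. Qed.

Lemma val_leM c x y : v x <= v y -> v (c * x) <= v (c * y).
Proof. by rewrite !Defs.valM; exact: vext_leD2l. Qed.

Lemma val_le_neq0 x y : y != 0 -> v x <= v y -> x != 0.
Proof.
move=> y0; apply: contraTneq => ->; rewrite val_zero.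
by case E: (v y) => [//|]; move/val_infty: E y0 => ->; rewrite eqxx.
Qed.

Lemma vint_div x y : y != 0 -> (x / y \in vint v) = (v y <= v x).
Proof.
move=> y0; rewrite unfold_in -(Defs.val1 v); apply/idP/idP => h.
  by have := val_leM y h; rewrite mulr1 mulrCA mulfV // mulr1.
by have := val_leM y^-1 h; rewrite mulVf // mulrC.
Qed.

Lemma vint_mulr c x : c \in vint v -> v x <= v (c * x).
Proof.
rewrite unfold_in -(Defs.val1 v) => h.
by have := val_leM x h; rewrite mulr1 mulrC.
Qed.

Lemma val_sub_lt x y : v x < v y -> v (x - y) = v x.
Proof.
move=> xy; apply/eqP; rewrite eq_le; apply/andP; split.
  rewrite leNgt; apply/negP => h.
  have := Defs.valD v (x - y) y; rewrite subrK leNgt lt_min h xy //.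
by have := Defs.valD v x (- y); rewrite val_opp min_l // ltW.
Qed.

Lemma val_prod_ratio s a a' e : e != 0 -> v e <= v (a' - a) ->
    {in s, forall b, v (a - b) <= v e} ->
  v ((a' - a) / e) <= v (\prod_(b <- s) ((a' - b) / (a - b)) - 1).
Proof.
move=> e0 ea; elim: s => [|b s IHs] hs.
  by rewrite big_nil subrr val_zero; case: (v _).
have {}/IHs IHs : {in s, forall b, v (a - b) <= v e}.
  by move=> x xs; apply: hs; rewrite inE xs orbT.
have be : v (a - b) <= v e by apply: hs; rewrite mem_head.
have b0 : a - b != 0 by exact: val_le_neq0 be.
rewrite big_cons; set P := \prod_(_ <- _) _ in IHs *.
have ea_int : (a' - a) / e \in vint v by rewrite vint_div.
have P_int : P \in vint v.
  rewrite -(subrK 1 P) rpredD ?rpred1 //.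
  by move: ea_int; rewrite !unfold_in => /le_trans; exact.
have -> : (a' - b) / (a - b) * P - 1 = (P - 1) + P * ((a' - a) / (a - b)).
  by field.
apply: le_trans (Defs.valD _ _ _); rewrite le_min IHs /=.
apply: le_trans (vint_mulr _ P_int).
have := val_leM ((a' - a) / (e * (a - b))) be.
congr (v _ <= v _); field; exact/andP.
Qed.

Lemma sub_ideal_gen (S T : set F) :
  (forall x, S x -> exists c y, [/\ c \in vint v, T y & x = c * y]) ->
  ideal_gen v S `<=` ideal_gen v T.
Proof.
move=> ST _ [n [c [s [cint [Ss ->]]]]].
have /choice[k /choice[y ky]] := fun i => ST _ (Ss i).
exists n, (fun i => c i * k i), y; split=> [i|].
  by rewrite rpredM //; case: (ky i).
split=> [i|]; first by case: (ky i).
by apply: eq_bigr => i _; case: (ky i) => _ _ ->; rewrite mulrA.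
Qed.

End ValuationTheory.

Section Degree.
Variables (K F : fieldType) (f : {rmorphism K -> F}).

Lemma adjunctionP b x : adjunction f b x ->
  exists p q, (map_poly f q).[b] != 0 /\
              x * (map_poly f q).[b] = (map_poly f p).[b].
Proof.
move=> [p [q ->]]; have [q0|q0] := eqVneq (map_poly f q).[b] 0.
  exists 0, 1; rewrite q0 invr0 mulr0 mul0r rmorph0 rmorph1 horner0 hornerC.
  by rewrite oner_neq0.
by exists p, q; rewrite divfK.
Qed.

Lemma adjunction_free_leq n (e : 'I_n -> F) b (g : {poly K}) :
    g != 0 -> root (map_poly f g) b -> (forall i, adjunction f b (e i)) ->
    (forall c : 'I_n -> K, \sum_i f (c i) * e i = 0 -> forall i, c i = 0) ->
  (n <= (size g).-1)%N.
Proof.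
move=> g0 /rootP gb be e_free.
have /choice[p /choice[q /all_and2[q0 epq]]] := fun i => adjunctionP (be i).
pose Q := \prod_i q i; pose P i := p i * \prod_(k | k != i) q k.
have Q0 : (map_poly f Q).[b] != 0.
  rewrite rmorph_prod horner_prod; apply/prodf_neq0 => i _; exact: q0.
have eP i : e i * (map_poly f Q).[b] = (map_poly f (P i)).[b].
  by rewrite /Q /P (bigD1 i) //= !rmorphM !hornerM mulrA epq.
have modP i : (map_poly f (P i)).[b] = (map_poly f (P i %% g)).[b].
  rewrite {1}(divp_eq (P i) g) rmorphD rmorphM hornerD hornerM gb.
  by rewrite mulr0 add0r.
rewrite leqNgt; apply/negP => lt_g_n.
pose M := \matrix_(i < n, k < (size g).-1) (P i %% g)`_k.
have : kermx M != 0.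
  by rewrite kermx_eq0 /row_free neq_ltn (leq_ltn_trans (rank_leq_col M)).
case/rowV0Pn => u /sub_kermxP uM; case/negP; apply/eqP/rowP => i.
rewrite mxE; move: i; apply: e_free.
apply: (mulIf Q0); rewrite mul0r mulr_suml.
have : \sum_i u 0 i *: (P i %% g) = 0.
  apply/polyP => k; rewrite coef_sum coef0.
  have [lt_k|le_k] := ltnP k (size g).-1.
    have := congr1 (fun A : 'rV_ _ => A 0 (Ordinal lt_k)) uM.
    rewrite !mxE => uMk; rewrite -[RHS]uMk.
    by apply: eq_bigr => i _; rewrite coefZ mxE.
  apply: big1 => i _; rewrite coefZ nth_default ?mulr0 //.
  apply: leq_trans le_k; rewrite -ltnS prednK ?ltn_modp //.
  by rewrite lt0n size_poly_eq0.
move/(congr1 (fun h => (map_poly f h).[b])).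
rewrite rmorph0 horner0 rmorph_sum horner_sum => /= rel; rewrite -[RHS]rel.
by apply: eq_bigr => i _; rewrite map_polyZ hornerZ -modP -eP mulrA.
Qed.

Lemma deg_leq_root b (g : {poly K}) :
  g != 0 -> root (map_poly f g) b -> (deg f b <= (size g).-1)%N.
Proof.
move=> g0 gb; rewrite /deg /degree_over; case: xgetP => // n _ [e [be e_basis]].
apply: (adjunction_free_leq g0 gb be) => c c0 i.
have : adjunction f b 0.
  by exists 0, 0; rewrite rmorph0 horner0 mul0r.
case/e_basis => c' [_ c'_uniq]; apply: (fmorph_inj f); rewrite rmorph0.
have /(congr1 (fun h : {ffun _} => h i)) :
    [ffun i => f (c i)] = [ffun=> 0] :> {ffun 'I_n -> F}.
  rewrite -(c'_uniq [ffun i => f (c i)]); first apply: c'_uniq.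
    split=> [k|]; first by exists 0; rewrite ?ffunE ?rmorph0.
    by rewrite big1 // => k _; rewrite ffunE mul0r.
  split=> [k|]; first by exists (c k); rewrite ?ffunE.
  by rewrite -[LHS]c0; apply: eq_bigr => k _; rewrite ffunE.
by rewrite !ffunE.
Qed.

Lemma deg1_range b : deg f b = 1%N -> range f b.
Proof.
rewrite /deg /degree_over; case: xgetP => [n nE [e [_ e_basis]] n1|] //.
move: nE e e_basis; rewrite n1 => _ e e_basis.
have span_e x : adjunction f b x -> exists c, x = f c * e ord0.
  case/e_basis => c [[c_f ->] _]; have [k _ ck] := c_f ord0.
  by exists k; rewrite big_ord1 ck.
have /span_e[k k1] : adjunction f b 1.
  by exists 1, 1; rewrite rmorph1 hornerC divr1.
have /span_e[l lb] : adjunction f b b.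
  by exists 'X, 1; rewrite rmorph1 map_polyX hornerX hornerC divr1.
have fk0 : f k != 0.
  by apply: contra_eq_neq k1 => ->; rewrite mul0r oner_neq0.
exists (l / k) => //; rewrite fmorph_div lb.
by rewrite -[LHS]mulr1 [X in _ * X = _]k1; field.
Qed.

End Degree.

Lemma dim_leq_deg (K F : fieldType) (f : {rmorphism K -> F})
    (L : fieldExtType K) (h : {rmorphism L -> F}) (a : L) :
    (forall c : K, h c%:A = f c) -> <<1; a>>%VS = {:L}%VS ->
  (\dim {:L} <= deg f (h a))%N.
Proof.
move=> hf gen_a.
have hmap p : (map_poly f p).[h a] = h (map_poly (in_alg L) p).[a].
  rewrite -horner_map -map_poly_comp; congr (_.[_]).
  by apply: eq_map_poly => c /=; rewrite hf.
have adjE x : adjunction f (h a) x <-> exists y, x = h y.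
  split=> [[p [q ->]]|[y ->]]; first by rewrite !hmap -fmorph_div; eexists.
  have : y \in <<1; a>>%VS by rewrite gen_a memvf.
  case/Fadjoin1_polyP => p ->; exists p, 1.
  by rewrite hmap rmorph1 hornerC divr1.
have h_sum n (c : 'I_n -> K) (e : 'I_n -> L) :
    h (\sum_i c i *: e i) = \sum_i f (c i) * h (e i).
  by rewrite rmorph_sum; apply: eq_bigr => i _; rewrite -mulr_algl rmorphM hf.
rewrite /deg /degree_over; case: xgetP => [n _ [e [eL e_basis]]|noN]; last first.
  case: (noN (\dim {:L})); exists (fun i => h (vbasis {:L})`_i).
  split=> [i|_ /adjE[y ->]]; first by apply/adjE; eexists.
  exists [ffun i => f (coord (vbasis {:L}) i y)]; split.
    split=> [i|]; first by rewrite ffunE; eexists.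
    rewrite {1}[y](coord_vbasis (memvf _)) h_sum.
    by apply: eq_bigr => i _; rewrite ffunE.
  move=> c [/= c_f yE]; apply/ffunP => i; rewrite ffunE.
  have /choice[k ck] : forall i, exists k, f k = c i.
    by move=> l; have [k _ <-] := c_f l; exists k.
  have -> : y = \sum_i k i *: (vbasis {:L})`_i.
    apply: (fmorph_inj h); rewrite yE h_sum.
    by apply: eq_bigr => l _; rewrite ck.
  by rewrite coord_sum_free ?ck // (basis_free (vbasisP _)).
have /choice[y ey] : forall i, exists y, e i = h y by move=> i; apply/adjE.
suff -> : {:L}%VS = <<[tuple y i | i < n]>>%VS.
  by rewrite (leq_trans (dim_span _)) ?size_tuple.
apply/eqP; rewrite eqEsubv subvf andbT; apply/subvP => x _.
have [|c [[c_f xE] _]] := e_basis (h x); first by apply/adjE; exists x.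
have /choice[k ck] : forall i, exists k, f k = c i.
  by move=> l; have [k _ <-] := c_f l; exists k.
have -> : x = \sum_i k i *: y i.
  apply: (fmorph_inj h); rewrite xE h_sum.
  by apply: eq_bigr => l _; rewrite ck ey.
apply: rpred_sum => i _; apply: rpredZ; apply: memv_span.
by apply/mapP; exists i; rewrite ?mem_enum.
Qed.

Lemma algebraic_fieldExt (K : fieldType) (L : fieldExtType K) :
  algebraic_ext (in_alg L).
Proof.
move=> x; have /polyOver1P[p pE] := minPolyOver 1%AS x.
exists p; last by rewrite -pE root_minPoly.
by rewrite -(map_poly_eq0 (in_alg L)) -pE monic_neq0 ?monic_minPoly.
Qed.

Lemma gal_alg (K : fieldType) (L : splittingFieldType K) (s : gal_of {:L})
  (c : K) : s c%:A = c%:A.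
Proof. by rewrite linearZ /= rmorph1. Qed.

(* The order of [s] is finite, so a strict inequality between [w x] and
   [w (s x)] would cycle. *)
Lemma val_gal (K : fieldType) (G : oagType) (v : valuation K G)
    (L : splittingFieldType K) (w : valuation L G) (s : gal_of {:L}) x :
  henselian v -> vequiv (vrestr w (in_alg L)) v -> w (s x) = w x.
Proof.
move=> hens wv.
have s_mono y t : (w y <= w t) = (w (s y) <= w (s t)).
  apply: (hens _ _ (@algebraic_fieldExt K L) _ _ w (vrestr w s)) => // c c'.
  by rewrite -wv /= !gal_alg.
have s_iter n y : iter n s y = (s ^+ n)%g y.
  elim: n => [|n IHn]; first by rewrite gal_id.
  by rewrite iterS IHn expgSr galM ?memvf.
have s_ord : iter #[s]%g s x = x by rewrite s_iter expg_order gal_id.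
have ord_s : #[s]%g = #[s]%g.-1.+1 by rewrite prednK.
have cycle (le_w : rel L) : reflexive le_w -> transitive le_w ->
    (forall y t, le_w y t = le_w (s y) (s t)) -> le_w x (s x) -> le_w (s x) x.
  move=> le_refl le_trans le_mono le_x; rewrite -[X in le_w _ X]s_ord ord_s.
  have step n : le_w (iter n s x) (iter n.+1 s x).
    by elim: n => // n; rewrite le_mono.
  by elim: _.-1 => [|n IHn] //; exact: le_trans IHn (step n.+1).
have [le_x|/ltW ge_x] := leP (w x) (w (s x)).
  apply/le_anti; rewrite le_x andbT.
  by apply: (cycle (fun y t => w y <= w t)) => // y t u; exact: le_trans.
apply/le_anti; rewrite ge_x /=.
by apply: (cycle (fun y t => w t <= w y)) => // y t u /[swap]; exact: le_trans.
Qed.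

Theorem theorem8p14
  (K : fieldType) (Kbar : closedFieldType)
  (iota : {rmorphism K -> Kbar}) (hKbar : algebraic_ext iota)
  (G : oagType) (v : valuation Kbar G)
  (hnontriv : nontrivial_valuation (vrestr v iota))
  (hhens : henselian (vrestr v iota))
  (L : splittingFieldType K) (j : {rmorphism L -> Kbar})
  (hj : forall c : K, j c%:A = iota c)
  (a : L) (hgen : <<1; a>>%VS = {:L}%VS)
  (hgal : galois 1%VS {:L}%VS)
  (d : nat) (hd : is_defect (vrestr v j) d) (hd1 : (1 < d)%N)
  (hpure : pure iota v (j a))
  (disp : Order.disp_t) (I : orderType disp) (hI : limit_order I)
  (z : I -> K)
  (hz : pseudo_convergent (vrestr v iota) z)
  (hnolim : ~ exists c : K, pseudo_limit (vrestr v iota) z c)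
  (hlim : pseudo_limit (vrestr v j) (fun nu => (z nu)%:A) a)
  (H : {group gal_of {:L}%VS}) (hH : (H \subset 'Gal({:L}%VS / 1%VS))%g) :
  galois_ideal (vrestr v j) H =
  ideal_gen (vrestr v j)
    [set y | exists s nu, s \in H /\ y = (s a - a) / (a - (z nu)%:A)].
Proof.
pose w := vrestr v j; pose b nu : L := a - (z nu)%:A.
have w_b nu : j (b nu) = j a - iota (z nu) by rewrite rmorphB hj.
have w_gal (s : gal_of {:L}) x : w (s x) = w x.
  by apply: val_gal hhens _ => c c' /=; rewrite !hj.
have gal_b (s : gal_of {:L}) nu : s (b nu) = s a - (z nu)%:A.
  by rewrite rmorphB /= gal_alg.
have b0 nu : b nu != 0.
  apply/eqP => /subr0_eq a_z; apply: hnolim; exists (z nu) => k l kl.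
  by have := hlim k l kl; rewrite /= a_z !rmorphB /= !hj.
have gal_int (s : gal_of {:L}) nu : w (b nu) <= w (s a - a).
  have -> : s a - a = s (b nu) - b nu by rewrite gal_b /b; ring.
  apply: le_trans (Defs.valD _ _ _).
  by rewrite val_opp w_gal le_min lexx.
(* As [c] is not a limit, [v (c - z nu) != v (a - z nu)] for some [nu]. *)
have near_K c : exists nu, v (j a - iota c) <= w (b nu).
  have : exists nu, v (iota c - iota (z nu)) <> w (b nu).
    apply: contrapT => h; apply: hnolim; exists c => k l kl.
    have := hlim k l kl; rewrite /= !rmorphB /= !hj => <-.
    by apply: contrapT => ne; apply: h; exists k; rewrite /w /= w_b.
  case=> nu ne; exists nu; rewrite leNgt; apply/negP => lt_bc; apply: ne.
  rewrite -[RHS](val_sub_lt lt_bc); congr (v _).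
  by rewrite w_b; ring.
have near_low x : (deg iota x < deg iota (j a))%N ->
    exists nu, v (j a - x) <= w (b nu).
  case: hpure => A [dg [_ A_deg [<- _ dg1] A_dist _ _ _]] /A_dist.
  case=> // y Ay le_xy; have := A_deg 1%N y isT Ay; rewrite dg1.
  case/deg1_range => c _ cy; have [nu le_nu] := near_K c.
  by exists nu; apply: le_trans le_xy _; rewrite -cy.
have near_seq (r : seq Kbar) :
    {in r, forall x, (deg iota x < deg iota (j a))%N} ->
    exists nu, {in r, forall x, v (j a - x) <= w (b nu)}.
  have [[nu0] _ _] := hI.
  elim: r => [|x r IHr] hr; first by exists nu0.
  have [|nu le_nu] := IHr; first by move=> y yr; rewrite hr // inE yr orbT.
  have [|mu le_mu] := near_low x; first by rewrite hr ?mem_head.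
  have [le_w|/ltW le_w] := leP (w (b nu)) (w (b mu)).
    exists mu => y; rewrite inE => /predU1P[-> //|/le_nu le_y].
    exact: le_trans le_y le_w.
  exists nu => y; rewrite inE => /predU1P[->|/le_nu //].
  exact: le_trans le_mu le_w.
apply/seteqP; split; apply: sub_ideal_gen => g /=.
  case=> s [x [sH x0 ->{g}]].
  have [p px p_size] : exists2 p, x = (map_poly (in_alg L) p).[a] &
      (size p <= \dim {:L})%N.
    have /Fadjoin_poly_eq xE : x \in <<1; a>>%VS by rewrite hgen memvf.
    have /polyOver1P[p pE] := Fadjoin_polyOver 1%AS a x.
    exists p; first by rewrite -pE xE.
    rewrite -hgen dim_Fadjoin dimv1 muln1 -(size_map_poly (in_alg L)) -pE.
    exact: size_Fadjoin_poly.
  have p0 : p != 0 by apply: contraNneq x0 => p0; rewrite px p0 rmorph0 horner0.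
  pose q := map_poly iota p.
  have j_horner y : j (map_poly (in_alg L) p).[y] = q.[j y].
    rewrite -horner_map -map_poly_comp; congr (_.[_]).
    by apply: eq_map_poly => c /=; rewrite hj.
  have [r qE] := closed_field_poly_normal q.
  have lq0 : lead_coef q != 0 by rewrite lead_coef_eq0 map_poly_eq0.
  have q_horner y : q.[y] = lead_coef q * \prod_(t <- r) (y - t).
    rewrite {1}qE hornerZ horner_prod; congr (_ * _).
    by apply: eq_bigr => t _; rewrite !hornerE.
  have [t tr|nu le_nu] := near_seq r.
    have t_root : root q t by rewrite qE rootZ // root_prod_XsubC.
    apply: leq_ltn_trans (deg_leq_root p0 t_root) _.
    apply: leq_trans (dim_leq_deg hj hgen); apply: leq_trans p_size.
    by rewrite prednK // lt0n size_poly_eq0.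
  have sxE : s x = (map_poly (in_alg L) p).[s a].
    rewrite px -horner_map -map_poly_comp; congr (_.[_]).
    by apply: eq_map_poly => c /=; rewrite gal_alg.
  pose y := (s a - a) / b nu.
  have w_le : w y <= w (s x / x - 1).
    have jx : j (s x / x) = \prod_(t <- r) ((j (s a) - t) / (j a - t)).
      rewrite fmorph_div sxE px !j_horner !q_horner -mulf_div divff // mul1r.
      by rewrite prodf_div.
    rewrite /w /= rmorphB jx rmorph1 fmorph_div rmorphB.
    apply: val_prod_ratio => //; first by rewrite fmorph_eq0.
    by rewrite -rmorphB; exact: gal_int.
  have [y0|y0] := eqVneq y 0.
    exists 0, y; split; [exact: rpred0 | by exists s, nu |].
    move: w_le; rewrite y0 val_zero mul0r.
    by case E: (w _) => // _; apply/(val_infty w).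
  exists ((s x / x - 1) / y), y.
  by split; [rewrite vint_div | exists s, nu | rewrite divfK].
case=> s [nu [sH ->{g}]]; exists 1, ((s a - a) / b nu).
split; [exact: rpred1 | | by rewrite mul1r].
exists s, (b nu); split=> //; rewrite gal_b /b; field; exact: b0.
Qed.
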